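(* Let $p$ be an odd prime and let $q$ be a prime and $s \geq 1$. Let $N(q^s)$ be the number of pairs $(a,b) \in (\mathbb{Z}/q^s\mathbb{Z})^2$ with $$\sum_{k=0}^{p}\binom{p}{k} 2^{\lfloor k/2 \rfloor} a^{p-k} b^k \equiv 1 \pmod{q^s}.$$ Then: (1) $N(q^s) = q^s$ if any of the following holds: (a) $q \notin \{p, 2\}$ and $q \not\equiv \pm 1 \pmod p$; (b) $q \equiv -1 \pmod p$ and $\left(\frac{2}{q}\right) = 1$; (c) $(q,s) = (p,1)$. (2) If $q \equiv -1 \pmod p$ and $\left(\frac{2}{q}\right) = -1$, then $N(q^s) = q^s + q^{s-1}$ when $1+\sqrt{2}$ is not a $p$th power in $\mathbb{F}_q(\sqrt{2})$, and $N(q^s) = q^s + (1-p)q^{s-1}$ when $1+\sqrt{2}$ is a $p$th power in $\mathbb{F}_q(\sqrt{2})$. (3) If $q = 2$, then $N(q^s) = 2^{s-1}$. (4) If $q \equiv 1 \pmod p$, or $q = p$ and $s > 1$, then $N(q^s) = p q^{s-1} d$ for some positive integer $d$ depending only on $p$ and $q$.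
   Context: $\left(\frac{2}{q}\right)$ is the Legendre symbol; $\mathbb{F}_q(\sqrt{2})$ is the field obtained by adjoining a square root of $2$ to the finite field $\mathbb{F}_q$. *)

(* Defs.v *)
From HB Require Import structures.
From mathcomp Require Import all_boot all_order all_algebra.
Set Implicit Arguments. Unset Strict Implicit. Unset Printing Implicit Defensive.
Import Order.TTheory GRing.Theory Num.Theory.

(* The polynomial sum_{k=0}^p C(p,k) 2^{floor(k/2)} a^{p-k} b^k, evaluated in nat
   (all coefficients are nonnegative, so reducing mod m afterwards is exact). *)
Definition Fp (p a b : nat) : nat :=
  \sum_(k < p.+1) 'C(p, k) * 2 ^ (k./2) * a ^ (p - k) * b ^ k.

Definition Npairs (p m : nat) : nat :=
  #|[set ab : 'I_m * 'I_m | Fp p ab.1 ab.2 %% m == 1 %% m]|.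

Definition legendre (a q : nat) : int :=
  if a %% q == 0 then 0%R
  else if [exists x : 'I_q, (x * x) %% q == a %% q] then 1%R else (-1)%R.

(* "1 + sqrt 2 is a p-th power in F_q(sqrt 2)", with F_q(sqrt 2) realised as
   F_q[X]/(X^2 - 2) (a field when 2 is a non-square mod q), sqrt 2 = class of X. *)
Definition one_plus_sqrt2_pth_power (p q : nat) : Prop :=
  exists f : {poly 'F_q},
    (('X ^+ 2 - 2%:P) %| (f ^+ p - (1 + 'X)))%R.

(* Main.v *)
(* Writing [alpha = a + b * sqrt 2] and [lsum (x + y * sqrt 2) = x + y], the form
   is [F (a, b) = lsum (alpha ^ p)].  Its gradient is [p] times
   [(lsum (alpha ^ (p-1)), lsum (sqrt 2 * alpha ^ (p-1)))], which vanishes mod [q]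
   only if [alpha ^ (p-1) = 0], hence only if [F (a, b) = 0].  So the solutions of
   [F = 1] lift by Hensel's lemma: for [q <> p] from [Z/q], for [q = p] from the
   pairs mod [p] with [F = 1] mod [p ^ 2].

   Over [F_q], with [q] odd, the Frobenius map multiplies [sqrt 2] by
   [2 ^ ((q-1)/2)], so [alpha ^ (q ^ 2) = alpha], and [alpha ^ q = alpha] when 2 is
   a square.  Hence [alpha |-> alpha ^ p] is a bijection in case (1), and [F = 1]
   has as many solutions as the linear equation [lsum = 1].  In case (2), every
   element of [F_q] is a [p]-th power, so by scaling all nonzero fibres of [F] have
   the same size, and the zero fibre consists of [0] and of [q - 1] copies of the
   set of [p]-th roots of [1 - sqrt 2].  In case (4), the [p]-th roots of unity of
   [F_q] act freely on the solutions, and [(1, 0)] is one. *)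
Require Import Defs.
From HB Require Import structures.
From mathcomp Require Import all_boot all_order all_algebra.
From mathcomp Require Import all_fingroup all_solvable all_field.
From mathcomp Require Import ring zify.
Import Order.TTheory GRing.Theory Num.Theory.
Set Implicit Arguments.
Unset Strict Implicit.
Unset Printing Implicit Defensive.

Local Open Scope ring_scope.

(** * The ring [R[sqrt 2]] and the form as [lsum] of a power *)

Lemma expr_odd_half (R : pzSemiRingType) (x : R) (n : nat) : odd n ->
  x ^+ n = x * (x ^+ 2) ^+ n./2.
Proof.
move=> n_odd; rewrite -exprM mul2n -exprS; congr (x ^+ _).
by rewrite -{1}(odd_double_half n) n_odd.
Qed.

(* The pair [(a, b)] stands for [a + b * sqrt 2]. *)
Definition zsqrt2 (R : Type) : Type := (R * R)%type.

HB.instance Definition _ (R : finType) := Finite.copy (zsqrt2 R) (R * R)%type.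
HB.instance Definition _ (R : zmodType) :=
  GRing.Zmodule.copy (zsqrt2 R) (R * R)%type.

Section ZSqrt2Ring.
Variable R : comNzRingType.
Implicit Types (x y z : zsqrt2 R) (a b c : R).

Definition zsqrt2_mul x y : zsqrt2 R :=
  (x.1 * y.1 + 2 * x.2 * y.2, x.1 * y.2 + x.2 * y.1).

Definition zsqrt2_one : zsqrt2 R := (1, 0).

Fact zsqrt2_mulA : associative zsqrt2_mul.
Proof. by move=> x y z; congr (_, _) => /=; ring. Qed.

Fact zsqrt2_mulC : commutative zsqrt2_mul.
Proof. by move=> x y; congr (_, _) => /=; ring. Qed.

Fact zsqrt2_mul1 : left_id zsqrt2_one zsqrt2_mul.
Proof. by case=> x1 x2; congr (_, _) => /=; ring. Qed.

Fact zsqrt2_mulD : left_distributive zsqrt2_mul +%R.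
Proof. by case=> x1 x2 [y1 y2] [z1 z2]; congr (_, _) => /=; ring. Qed.

Fact zsqrt2_1neq0 : zsqrt2_one != 0.
Proof. by rewrite xpair_eqE oner_eq0. Qed.

HB.instance Definition _ := GRing.Zmodule_isComNzRing.Build (zsqrt2 R)
  zsqrt2_mulA zsqrt2_mulC zsqrt2_mul1 zsqrt2_mulD zsqrt2_1neq0.

Definition zpair a b : zsqrt2 R := (a, b).
Definition emb a : zsqrt2 R := (a, 0).
Definition sqrt2 : zsqrt2 R := (0, 1).

Lemma zsqrt2_mulE x y :
  x * y = (x.1 * y.1 + 2 * x.2 * y.2, x.1 * y.2 + x.2 * y.1).
Proof. by []. Qed.

Fact emb_is_additive : zmod_morphism emb.
Proof. by move=> a b; congr (_, _); rewrite subr0. Qed.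

Fact emb_is_monoid : monoid_morphism emb.
Proof. by split=> // a b; rewrite zsqrt2_mulE; congr (_, _) => /=; ring. Qed.

HB.instance Definition _ := GRing.isZmodMorphism.Build R (zsqrt2 R) emb emb_is_additive.
HB.instance Definition _ := GRing.isMonoidMorphism.Build R (zsqrt2 R) emb emb_is_monoid.

Lemma embM a b : emb (a * b) = emb a * emb b.
Proof. exact: rmorphM. Qed.

Lemma embX a n : emb (a ^+ n) = emb a ^+ n.
Proof. exact: rmorphXn. Qed.

Lemma zsqrt2E x : x = emb x.1 + emb x.2 * sqrt2.
Proof. by case: x => a b; rewrite zsqrt2_mulE; congr (_, _) => /=; ring. Qed.

Lemma sqrt2_sqr : sqrt2 ^+ 2 = emb 2.
Proof. by rewrite expr2 zsqrt2_mulE; congr (_, _) => /=; ring. Qed.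

Definition lsum x : R := x.1 + x.2.

Fact lsum_is_additive : zmod_morphism lsum.
Proof. by case=> a b [c d]; rewrite /lsum /=; ring. Qed.

HB.instance Definition _ := GRing.isZmodMorphism.Build (zsqrt2 R) R lsum lsum_is_additive.

Lemma lsumD x y : lsum (x + y) = lsum x + lsum y.
Proof. exact: raddfD. Qed.

Lemma lsumMn x n : lsum (x *+ n) = lsum x *+ n.
Proof. exact: raddfMn. Qed.

Lemma lsumZ a x : lsum (emb a * x) = a * lsum x.
Proof. by rewrite /lsum /=; ring. Qed.

Lemma sqrt2_exp_odd n : odd n -> sqrt2 ^+ n = emb (2 ^+ n./2) * sqrt2.
Proof. by move=> n_odd; rewrite expr_odd_half // sqrt2_sqr -embX mulrC. Qed.

(** [sqrt2 ^ k] is [2 ^ (k/2)] for even [k] and [2 ^ ((k-1)/2)] times [sqrt2] for odd [k], and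
    [lsum] sends both [1] and [sqrt2] to [1]. This is the source of the floor in the form. *)
Lemma lsum_sqrt2X k : lsum (sqrt2 ^+ k) = 2 ^+ k./2.
Proof.
have l1 : lsum sqrt2 = 1 by rewrite /lsum /= add0r.
have [k_odd|k_even] := boolP (odd k).
  by rewrite sqrt2_exp_odd // lsumZ l1 mulr1.
by rewrite -{1}(even_halfK k_even) -mul2n exprM sqrt2_sqr -embX /lsum /= addr0.
Qed.

Lemma natr_Fp (n a b : nat) : (Fp n a b)%:R = lsum (zpair a%:R b%:R ^+ n).
Proof.
rewrite /Fp natr_sum [X in X ^+ n]zsqrt2E /= exprDn [RHS]raddf_sum.
apply: eq_bigr => k _; rewrite exprMn mulrA -!embX -embM raddfMn /=.
rewrite lsumZ lsum_sqrt2X -mulr_natl !natrM !natrX; ring.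
Qed.

(** For [x = (a, b)] the hypotheses read [a + b = 0] and [a + 2b = 0], a system of determinant 1,
    hence solvable over any ring. *)
Lemma lsum_eq0 x : lsum x = 0 -> lsum (sqrt2 * x) = 0 -> x = 0.
Proof.
case: x => a b; rewrite /lsum /= => h1 h2.
have hb : b = 0.
  have -> : b = (0 * a + 2 * 1 * b + (0 * b + 1 * a)) - (a + b) by ring.
  by rewrite h1 h2 subr0.
by move: h1; rewrite hb addr0 => ->.
Qed.

End ZSqrt2Ring.

(** * Power maps, linear equations and reduction to ['F_q] *)

Lemma expr_injective (R : comNzRingType) (n p : nat) : (0 < n)%N ->
  coprime p n.-1 -> (0 < p)%N -> (forall x : R, x ^+ n = x) ->
  injective (fun x : R => x ^+ p).
Proof.
move=> n0 cop p0 fixn.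
(* Bezout gives [u * p = v * (n - 1) + 1], so the power [u] undoes the power [p]. The identity
   [x ^ n = x] also covers zero divisors. *)
have [u v def_u _] := egcdnP n.-1 p0.
have fix1 k (x : R) : x ^+ (k * n.-1 + 1) = x.
  elim: k => [|k IHk]; first exact: expr1.
  by rewrite mulSn -addnA exprD IHk -exprSr prednK.
have inv (x : R) : (x ^+ p) ^+ u = x.
  by rewrite -exprM mulnC def_u (eqP cop) fix1.
by move=> x y /= exy; rewrite -[x]inv exy inv.
Qed.

(** An odd prime cannot divide both [q - 1] and [q + 1], whose difference is 2. *)
Lemma coprime_predn p q : prime p -> odd p -> prime q ->
  ((q + 1) %% p == 0)%N -> coprime p q.-1.
Proof.
move=> p_pr p_odd q_pr qN1; rewrite prime_coprime //; apply/negP => dv.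
have : (p %| (q + 1) - q.-1)%N by apply: dvdn_sub.
have -> : ((q + 1) - q.-1 = 2)%N by have := prime_gt0 q_pr; lia.
by rewrite gtnNdvd // odd_prime_gt2.
Qed.

Lemma card_linear_eq (F : finFieldType) (u v c : F) : (u != 0) || (v != 0) ->
  #|[set z : F * F | u * z.1 + v * z.2 == c]| = #|F|.
Proof.
have [u0 _|u0 /= v0] := boolP (u != 0).
  pose f t : F * F := ((c - v * t) / u, t).
  rewrite -cardsT -(card_imset (f := f) setT); last by move=> s t [].
  apply: eq_card => -[x y]; rewrite !inE /=.
  apply/eqP/imsetP => [e|[t _ [-> ->]]]; last by field.
  by exists y => //; rewrite /f -e; congr (_, _); field.
rewrite negbK in u0; rewrite (eqP u0).
pose f t : F * F := (t, c / v).
rewrite -cardsT -(card_imset (f := f) setT); last by move=> s t [].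
apply: eq_card => -[x y]; rewrite !inE /=.
apply/eqP/imsetP => [e|[t _ [-> ->]]]; last by field.
by exists x => //; rewrite /f -e; congr (_, _); field.
Qed.

(** The bound of the ordinal type ['F_q] is not literally [q], so pairs are transported along
    [%:R]. *)
Lemma card_ord_Fp (q : nat) (P : pred ('F_q * 'F_q)) : prime q ->
  #|[set z : 'I_q * 'I_q | P (z.1%:R, z.2%:R)]| = #|[set z | P z]|.
Proof.
move=> q_pr.
pose f (z : 'I_q * 'I_q) : 'F_q * 'F_q := (z.1%:R, z.2%:R).
have f1 : injective (fun i : 'I_q => i%:R : 'F_q).
  move=> i j /(congr1 val) /=; rewrite !val_Fp_nat // !modn_small //.
  exact: val_inj.
rewrite -(card_imset (f := f)); last first.
  by move=> [i j] [k l] [/f1-> /f1->].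
apply: eq_card => -[x y]; rewrite !inE.
apply/imsetP/idP => [[[i j]]|Pxy].
  by rewrite inE => Pij [-> ->].
have lt (w : 'F_q) : (w < q)%N by rewrite -[X in (_ < X)%N](Fp_cast q_pr).
exists (Ordinal (lt x), Ordinal (lt y)); last by rewrite /f /= !natr_Zp.
by rewrite inE /= !natr_Zp.
Qed.

(** * Solutions over [F_q] through the Frobenius map *)

Section FiniteField.
Variable q : nat.
Hypothesis q_pr : prime q.
Implicit Types x y : zsqrt2 'F_q.

Lemma pchar_zsqrt2 : q \in [pchar (zsqrt2 'F_q)].
Proof.
rewrite inE q_pr -(rmorph_nat (@emb 'F_q)) /=.
by rewrite (pcharf0 (pchar_Fp q_pr)) rmorph0.
Qed.

Lemma Fp_expf (a : 'F_q) : a ^+ q = a.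
Proof. by rewrite -[X in _ ^+ X](card_Fp q_pr) expf_card. Qed.

Lemma zsqrt2_frobenius x : odd q ->
  x ^+ q = emb x.1 + emb (2 ^+ q./2 * x.2) * sqrt2 'F_q.
Proof.
move=> q_odd; rewrite {1}[x]zsqrt2E exprDn_pchar; last first.
  by rewrite pnatE // pchar_zsqrt2.
rewrite exprMn -!embX !Fp_expf.
by rewrite sqrt2_exp_odd // mulrA -embM [_ * x.2]mulrC.
Qed.

Lemma Fp_euler2 : odd q -> (2 ^+ q./2) ^+ 2 = 1 :> 'F_q.
Proof.
move=> q_odd; have two0 : 2 != 0 :> 'F_q.
  by rewrite -(dvdn_pcharf (pchar_Fp q_pr)) gtnNdvd // odd_prime_gt2.
(* Twice the left-hand side is [2 ^ q], which is 2 by Fermat. *)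
apply: (mulfI two0); by rewrite mulr1 exprAC -expr_odd_half // Fp_expf.
Qed.

Lemma zsqrt2_expqq x : odd q -> x ^+ (q ^ 2) = x.
Proof.
move=> q_odd; rewrite expnS expn1 exprM !zsqrt2_frobenius //=.
rewrite [RHS]zsqrt2E; rewrite /emb /sqrt2 !zsqrt2_mulE.
have := Fp_euler2 q_odd; rewrite expr2; set c := _ ^+ _ => c2.
congr (_, _) => /=; first by ring.
transitivity (c * c * x.2); [ring | by rewrite c2; ring].
Qed.

Definition nsol p := #|[set x : zsqrt2 'F_q | lsum (x ^+ p) == 1]|.

Lemma Npairs_prime p : Npairs p q = nsol p.
Proof.
rewrite /nsol -(card_ord_Fp (fun x : zsqrt2 'F_q => lsum (x ^+ p) == 1)) //.
rewrite /Npairs; apply: eq_card => -[a b]; rewrite !inE -natr_Fp /=.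
by rewrite -[X in _ = (_ == X)]/(1%:R) -(inj_eq (@ord_inj _)) !val_Fp_nat.
Qed.

Lemma nsol_injective p : injective (fun x : zsqrt2 'F_q => x ^+ p) -> nsol p = q.
Proof.
move=> inj; have -> : nsol p = #|[set x : zsqrt2 'F_q | lsum x == 1]|.
  rewrite /nsol -[LHS](card_imset _ inj); apply: eq_card => y; rewrite inE.
  apply/imsetP/idP => [[x]|ly]; first by rewrite inE => lx ->.
  have [g fg gf] := injF_bij inj.
  by exists (g y); rewrite ?inE (gf y).
rewrite -[RHS](card_Fp q_pr) -(card_linear_eq (u := 1) (v := 1) 1) ?oner_eq0 //.
by apply: eq_card => x; rewrite !inE !mul1r.
Qed.

(** By the Frobenius formula the form of degree [q] is itself linear: [a + 2 ^ ((q-1)/2) * b]. *)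
Lemma nsol_char : odd q -> nsol q = q.
Proof.
move=> q_odd.
rewrite -[RHS](card_Fp q_pr) -(card_linear_eq (u := 1) (v := 2 ^+ q./2) 1) ?oner_eq0 //.
apply: eq_card => x; rewrite !inE zsqrt2_frobenius // raddfD /= lsumZ.
by rewrite /lsum /= addr0 add0r mulr1 mul1r.
Qed.

(** The exponent [q ^ 2] fixes every element whether or not 2 is a square, and [p] divides neither
    factor of [q ^ 2 - 1 = (q - 1)(q + 1)]. *)
Lemma nsol_not_pm1 p : prime p -> odd q -> (q %% p != 1)%N ->
  ((q + 1) %% p != 0)%N -> nsol p = q.
Proof.
move=> p_pr q_odd q1 qN1.
apply: nsol_injective; apply: (@expr_injective _ (q ^ 2)) => [||| x].
- by rewrite expn_gt0 prime_gt0.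
- rewrite prime_coprime // -subn1 (subn_sqr q 1) Euclid_dvdM // negb_or.
  by rewrite -eqn_mod_dvd ?prime_gt0 // (modn_small (prime_gt1 p_pr)) q1.
- exact: prime_gt0.
- exact: zsqrt2_expqq.
Qed.

Lemma legendre2_odd : legendre 2 q != 0 -> odd q.
Proof.
by rewrite /legendre; case: (even_prime q_pr) => [->|//]; rewrite eqxx.
Qed.

Lemma legendre2_1P : legendre 2 q = 1 -> exists a : 'F_q, a ^+ 2 = 2.
Proof.
rewrite /legendre; case: eqP => // _; case: existsP => // -[x /eqP ex _].
exists x%:R; apply: ord_inj; rewrite -natrX.
by rewrite !val_Fp_nat // -ex mulnn.
Qed.

Lemma legendre2_N1P (a : 'F_q) : legendre 2 q = -1 -> a ^+ 2 != 2.
Proof.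
rewrite /legendre; case: eqP => // _; case: existsP => // nex _.
apply/eqP=> a2; apply: nex.
have lt : (a < q)%N by rewrite -[X in (_ < X)%N](Fp_cast q_pr).
exists (Ordinal lt); apply/eqP; rewrite /= -!val_Fp_nat // natrM natr_Zp.
by rewrite -expr2 a2.
Qed.

(** If [2 = a ^ 2], then [2 ^ ((q-1)/2) = a ^ (q-1) = 1], so already the exponent [q] fixes every
    element, and [p] is coprime to [q - 1]. *)
Lemma nsol_split p : prime p -> odd p -> ((q + 1) %% p == 0)%N ->
  legendre 2 q = 1 -> nsol p = q.
Proof.
move=> p_pr p_odd qN1 leg.
have q_odd : odd q by apply: legendre2_odd; rewrite leg.
apply: nsol_injective; apply: (@expr_injective _ q) => [||| x].
- exact: prime_gt0.
- exact: coprime_predn.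
- exact: prime_gt0.
have [a a2] := legendre2_1P leg.
have -> : x ^+ q = emb x.1 + emb (2 ^+ q./2 * x.2) * sqrt2 'F_q.
  exact: zsqrt2_frobenius.
rewrite [RHS]zsqrt2E; congr (_ + emb _ * _).
have a0 : a != 0.
  (* If [a = 0] then [2 = 0], and a positive power of 2 could not square to 1. *)
  apply/eqP => a0; have := Fp_euler2 q_odd; rewrite -a2 a0 expr0n /= expr0n.
  have -> : (q./2 == 0)%N = false by have := odd_prime_gt2 q_odd q_pr; lia.
  by rewrite expr0n => /eqP; rewrite eq_sym oner_eq0.
suff -> : 2 ^+ q./2 = 1 :> 'F_q by rewrite mul1r.
apply: (mulfI a0); by rewrite mulr1 -a2 -expr_odd_half // Fp_expf.
Qed.

End FiniteField.

(** Modulo 2 the square of [x] is [x.1], so [x ^ p] is [x.1] times [x], and the form becomes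
    [x.1 * (x.1 + x.2)], which is 1 only at [(1, 0)]. *)
Lemma nsol_2 p : odd p -> (1 < p)%N -> nsol 2 p = 1%N.
Proof.
move=> p_odd p_gt1; rewrite /nsol -[RHS](cards1 (1 : zsqrt2 'F_2)).
have two0 : 2 = 0 :> 'F_2 by apply/val_inj.
have idem (a : 'F_2) : a ^+ 2 = a by rewrite (Fp_expf (q := 2)).
apply: eq_card => x; rewrite !inE expr_odd_half //.
have -> : (x ^+ 2) ^+ p./2 = emb x.1.
  have -> : x ^+ 2 = emb x.1.
    rewrite expr2 zsqrt2_mulE two0 /emb -expr2 idem.
    by congr (_, _); rewrite ?mul0r ?addr0 // mulrC -mulr2n -mulr_natl two0 mul0r.
  have -> : p./2 = (p./2).-1.+1 by rewrite prednK // half_gt0.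
  elim: (p./2).-1 => [|k IHk]; first exact: expr1.
  by rewrite exprS IHk -embM -expr2 idem.
rewrite mulrC lsumZ /lsum.
by case: x => -[[|[|//]] ?] [[|[|//]] ?].
Qed.

(** * Roots of unity and fibres of power maps *)

Lemma sum_card_fibers (T U : finType) (f : T -> U) :
  (\sum_u #|[set x | f x == u]| = #|T|)%N.
Proof.
rewrite -sum1_card (partition_big f xpredT) //=.
by apply: eq_bigr => u _; rewrite -sum1dep_card.
Qed.

Lemma exists_prim_root (K : finFieldType) p : prime p -> (p %| #|K|.-1)%N ->
  exists z : K, p.-primitive_root z.
Proof.
move=> p_pr; rewrite -card_finField_unit => dvp.
have [u _ ou] := Cauchy p_pr dvp.
have zp : val u ^+ p = 1.
  by rewrite -FinRing.val_unitX -ou expg_order FinRing.val_unit1.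
have [m prim_m dvm] := prim_order_exists (prime_gt0 p_pr) zp.
have [_ /(_ m dvm)/orP[]/eqP m_eq] := primeP p_pr; last first.
  by exists (val u); rewrite -m_eq.
have u1 : u = 1%g.
  by apply: val_inj; have := prim_expr_order prim_m; rewrite m_eq expr1.
by move: p_pr; rewrite -ou u1 order1.
Qed.

Lemma card_unity_roots (K : finFieldType) p : prime p -> (p %| #|K|.-1)%N ->
  #|[set x : K | x ^+ p == 1]| = p.
Proof.
move=> p_pr dvp; have [z prim_z] := exists_prim_root p_pr dvp.
rewrite -[RHS]card_ord -cardsT.
rewrite -(card_imset (f := fun i : 'I_p => z ^+ i)); last first.
  move=> i j /eqP; rewrite (eq_prim_root_expr prim_z) !modn_small //.
  by move/eqP/val_inj.
apply: eq_card => x; rewrite inE; apply/eqP/imsetP => [x1|[i _ ->]].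
  by have [i ->] := prim_rootP prim_z x1; exists i.
by rewrite exprAC (prim_expr_order prim_z) expr1n.
Qed.

(** Multiplication by one root [y] maps the [p]-th roots of unity onto the [p]-th roots of [c]. *)
Lemma card_pth_roots (K : finFieldType) p (c : K) : prime p -> (p %| #|K|.-1)%N ->
  c != 0 -> (exists x, x ^+ p = c) -> #|[set x : K | x ^+ p == c]| = p.
Proof.
move=> p_pr dvp c0 [y yc]; rewrite -[RHS](card_unity_roots p_pr dvp).
have y0 : y != 0.
  by apply: contraNneq c0 => y0; rewrite -yc y0 expr0n gtn_eqF ?prime_gt0.
rewrite -[RHS](card_imset _ (mulfI y0)); apply: eq_card => x; rewrite inE.
apply/eqP/imsetP => [xc|[w]].
  exists (x / y); last by field.
  by rewrite inE expr_div_n xc yc divff.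
by rewrite inE => /eqP w1 ->; rewrite exprMn w1 mulr1.
Qed.

Lemma emb_mul_eq0 (F : fieldType) (a : F) (x : zsqrt2 F) :
  a != 0 -> emb a * x = 0 -> x = 0.
Proof.
move=> a0 ax; have : emb a^-1 * (emb a * x) = 0 by rewrite ax mulr0.
by rewrite mulrA -embM mulVf // mul1r.
Qed.

Lemma dvdn_nsol p q : prime p -> prime q -> (q %% p = 1)%N -> (p %| nsol q p)%N.
Proof.
move=> p_pr q_pr q1; have dvp : (p %| #|'F_q|.-1)%N.
  by rewrite card_Fp // -subn1 -eqn_mod_dvd ?prime_gt0 // q1 modn_small ?prime_gt1.
have [z prim_z] := exists_prim_root p_pr dvp.
have z0 : z != 0.
  by rewrite (prim_root_eq0 prim_z) -lt0n prime_gt0.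
pose f (x : zsqrt2 'F_q) := emb z * x.
have iterf i x : iter i f x = emb (z ^+ i) * x.
  elim: i => [|i IHi]; first by rewrite expr0 mul1r.
  by rewrite iterS IHi /f mulrA -embM -exprS.
have finj : injective f.
  apply: (can_inj (g := fun x => emb z^-1 * x)) => x.
  by rewrite /f mulrA -embM mulVf // mul1r.
(* The solutions form a set closed under [f] on which every orbit has size [p], so their number is
   [p] times the number of orbits. *)
rewrite /nsol -(fcard_order_set finj (n := p)).
- exact: dvdn_mull.
- apply/subsetP => x; rewrite !inE => /eqP lx.
  have x0 : x != 0.
    apply/eqP => x0; move/eqP: lx.
    by rewrite x0 expr0n gtn_eqF ?prime_gt0 // raddf0 eq_sym oner_eq0.
  rewrite eqn_leq; apply/andP; split.
    rewrite leqNgt; apply/negP => lt.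
    (* In an orbit longer than [p], the [p]-th iterate would have index [p]; but it is [x], of index
       0. *)
    have := findex_iter lt.
    rewrite iterf (prim_expr_order prim_z) mul1r findex0 => p0.
    by rewrite -p0 in p_pr.
  apply: dvdn_leq; first exact: fingraph.order_gt0.
  rewrite (prim_order_dvd prim_z).
  (* Here [(z ^ o - 1) x = 0] with [x] nonzero; a nonzero scalar is invertible, so [z ^ o = 1] and
     [p] divides the orbit size [o]. *)
  have := iter_order finj x; rewrite iterf; set o := fingraph.order f x => e.
  rewrite -subr_eq0; set w := _ - 1; apply/negPn/negP => w0; case/negP: x0.
  apply/eqP; apply: (emb_mul_eq0 w0).
  by rewrite rmorphB /= mulrBl e mul1r subrr.
move=> x y /eqP <-; rewrite !inE /f exprMn -embX (prim_expr_order prim_z).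
by rewrite mul1r.
Qed.

(** * The field [F_q(sqrt 2)] when 2 is a non-square *)

Section ZSqrt2Field.
Variable F : fieldType.
Hypothesis nonsquare2 : forall a : F, a ^+ 2 != 2.
Implicit Types x y : zsqrt2 F.

(** A zero norm with [b] nonzero would make 2 the square of [a / b]. *)
Lemma zsqrt2_norm_neq0 x : x != 0 -> x.1 ^+ 2 - 2 * x.2 ^+ 2 != 0.
Proof.
case: x => a b /=; apply: contra; rewrite subr_eq0 => /eqP e.
have [b0|b0] := eqVneq b 0.
  by move/eqP: e; rewrite b0 expr0n mulr0 sqrf_eq0 => /eqP ->.
by have /eqP[] := nonsquare2 (a / b); rewrite expr_div_n e mulfK // sqrf_eq0.
Qed.

(** The conjugate divided by the norm. *)
Definition zsqrt2_inv x : zsqrt2 F :=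
  let n := x.1 ^+ 2 - 2 * x.2 ^+ 2 in (x.1 / n, - x.2 / n).

Fact zsqrt2_mulVx x : x != 0 -> zsqrt2_inv x * x = 1.
Proof.
move=> /zsqrt2_norm_neq0 n0; rewrite /zsqrt2_inv zsqrt2_mulE.
by congr (_, _) => /=; field.
Qed.

Fact zsqrt2_inv0 : zsqrt2_inv 0 = 0.
Proof. by congr (_, _); rewrite /= ?oppr0 mul0r. Qed.

End ZSqrt2Field.

(** The field structure depends on the proof [h], so it is packed explicitly on the same carrier. *)
Definition zsqrt2_finField (F : finFieldType) (h : forall a : F, a ^+ 2 != 2) :
  finFieldType :=
  HB.pack (zsqrt2 F)
    (GRing.ComNzRing_isField.Build (zsqrt2 F) (zsqrt2_mulVx h) (zsqrt2_inv0 F)).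

Lemma card_scale (F : finFieldType) (P : pred (zsqrt2 F)) (d : F) : d != 0 ->
  #|[set x | P (emb d * x)]| = #|[set x | P x]|.
Proof.
move=> d0; have dK : cancel (fun x => emb d * x) (fun x => emb d^-1 * x).
  by move=> x; rewrite mulrA -embM mulVf // mul1r.
have dVK : cancel (fun x => emb d^-1 * x) (fun x => emb d * x).
  by move=> x; rewrite mulrA -embM mulfV // mul1r.
rewrite -[LHS](card_imset _ (can_inj dK)); apply: eq_card => x; rewrite inE.
apply/imsetP/idP => [[y]|Px]; first by rewrite inE => Py ->.
by exists (emb d^-1 * x); rewrite ?inE dVK.
Qed.

Lemma lsum_eq0_line (R : comNzRingType) (x : zsqrt2 R) (t : R) :
  (lsum x == 0) && (x.1 == t) = (x == emb t * zpair 1 (-1)).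
Proof.
case: x => a b; rewrite /lsum zsqrt2_mulE xpair_eqE /=.
rewrite !(mulr0, mul0r, oppr0, addr0, mulr1, mulrN1) andbC.
by case: (eqVneq a t) => //= ->; rewrite addrC addr_eq0.
Qed.

(* [1 - sqrt 2], the conjugate of [1 + sqrt 2], spans the kernel of [lsum]. *)
Definition npre_conj_unit q p :=
  #|[set x : zsqrt2 'F_q | x ^+ p == zpair 1 (-1)]|.

(** With [n = nsol q p] and [m = npre_conj_unit q p], sorting all elements by the value of the form
    gives [q ^ 2 = 1 + (q - 1) m + (q - 1) n]; then [q - 1] is cancelled. *)
Lemma nsol_nonsplit q p : prime q -> prime p -> odd p ->
  ((q + 1) %% p == 0)%N -> legendre 2 q = -1 ->
  (nsol q p + npre_conj_unit q p = q.+1)%N.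
Proof.
move=> q_pr p_pr p_odd qN1 leg.
have h (a : 'F_q) : a ^+ 2 != 2 by apply: legendre2_N1P.
pose K := zsqrt2_finField h.
have pinj : injective (fun a : 'F_q => a ^+ p).
  apply: (@expr_injective _ q); rewrite ?prime_gt0 //; last exact: Fp_expf.
  exact: coprime_predn.
have psurj (c : 'F_q) : c != 0 -> exists2 d : 'F_q, d != 0 & c = d ^+ p.
  have [g _ gK] := injF_bij pinj; move=> c0; exists (g c); last by rewrite [RHS]gK.
  apply: contraNneq c0 => g0; rewrite -[c]gK g0.
  by rewrite expr0n gtn_eqF ?prime_gt0.
have const0 (f : 'F_q -> nat) m : (forall t, t != 0 -> f t = m) ->
    (\sum_t f t = f 0%R + q.-1 * m)%N.
  move=> fm; rewrite (bigD1 0) //= (eq_bigr (fun _ => m)) => [|t t0]; last exact: fm.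
  by rewrite sum_nat_const cardC1 card_Fp.
pose w : zsqrt2 'F_q := zpair 1 (-1).
have zero_fiber : #|[set x : zsqrt2 'F_q | lsum (x ^+ p) == 0]| =
    (1 + q.-1 * npre_conj_unit q p)%N.
  (* The zero fibre is sliced by the first coordinate [t] of [x ^ p], which then equals [t] times
     [1 - sqrt2]. *)
  transitivity (\sum_t #|[set x : zsqrt2 'F_q | (x ^+ p == emb t * w)%R]|)%N.
    rewrite -sum1_card (partition_big (fun x : zsqrt2 'F_q => (x ^+ p).1) xpredT) //=.
    apply: eq_bigr => t _; rewrite -sum1_card; apply: eq_bigl => x.
    by rewrite !inE; apply: lsum_eq0_line.
  (* The slice [t = 0] contains only [x = 0], since [K] is a field; for [t = d ^ p] nonzero, scaling
     by [d] reduces to [t = 1]. *)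
  rewrite (const0 _ (npre_conj_unit q p)) => [|t t0].
    rewrite rmorph0; congr (_ + _)%N; rewrite -(cards1 (0 : zsqrt2 'F_q)).
    apply: eq_card => x; rewrite !inE mul0r.
    by have := expf_eq0 (x : K) p; rewrite prime_gt0 //= => <-.
  have [d d0 ->] := psurj t t0.
  rewrite -(card_scale _ d0); apply: eq_card => x; rewrite !inE exprMn -embX.
  have dp0 : d ^+ p != 0 by rewrite expf_neq0.
  rewrite -subr_eq0 -mulrBr -[X in _ = X]subr_eq0; apply/eqP/eqP => [e|->].
    exact: emb_mul_eq0 dp0 e.
  by rewrite mulr0.
have := sum_card_fibers (fun x : zsqrt2 'F_q => lsum (x ^+ p)).
rewrite (const0 _ (nsol q p)) => [|c c0]; last first.
  have [d d0 ->] := psurj c c0; rewrite -(card_scale _ d0).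
  apply: eq_card => x; rewrite !inE exprMn -embX lsumZ.
  by rewrite -{2}[d ^+ p]mulr1 (inj_eq (mulfI _)) ?expf_neq0.
rewrite zero_fiber.
have -> : #|{: zsqrt2 'F_q}| = (q * q)%N.
  by rewrite -[X in _ = (X * X)%N](card_Fp q_pr) -card_prod.
have q1 : (0 < q.-1)%N by have := prime_gt1 q_pr; lia.
move: (nsol q p) (npre_conj_unit q p) => a b e.
apply/eqP; rewrite -(eqn_pmul2l q1); apply/eqP.
by have := prime_gt0 q_pr; nia.
Qed.

(** * The [p]-th powers of [F_q[X]/(X^2 - 2)] in coordinates *)

Section PthPowers.
Variable q : nat.

Lemma emb_sqrt2_comm : commr_rmorph (@emb 'F_q) (sqrt2 'F_q).
Proof. by move=> a; apply: mulrC. Qed.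

Definition eval_sqrt2 : {rmorphism {poly 'F_q} -> zsqrt2 'F_q} :=
  horner_morph emb_sqrt2_comm.

Lemma eval_sqrt2C c : eval_sqrt2 c%:P = emb c.
Proof. exact: horner_morphC. Qed.

Lemma eval_sqrt2X : eval_sqrt2 'X = sqrt2 'F_q.
Proof. exact: horner_morphX. Qed.

Lemma eval_sqrt2_linear (a b : 'F_q) : eval_sqrt2 (a%:P + b%:P * 'X) = zpair a b.
Proof.
by rewrite rmorphD rmorphM !eval_sqrt2C eval_sqrt2X [RHS]zsqrt2E.
Qed.

Lemma eval_sqrt2_modulus : eval_sqrt2 ('X ^+ 2 - 2%:P) = 0.
Proof.
by rewrite rmorphB rmorphXn eval_sqrt2C eval_sqrt2X sqrt2_sqr subrr.
Qed.

(** The remainder modulo [X^2 - 2] is some [r0 + r1 X], whose value at [sqrt2] is the pair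
    [(r0, r1)]. *)
Lemma dvdp_eval_sqrt2 (h : {poly 'F_q}) : ('X ^+ 2 - 2%:P %| h) = (eval_sqrt2 h == 0).
Proof.
set m := 'X ^+ 2 - 2%:P; apply/idP/eqP => [/dvdpP[g ->]|e].
  by rewrite rmorphM eval_sqrt2_modulus mulr0.
have sm : size m = 3 by rewrite size_XnsubC.
have m0 : m != 0 by rewrite -size_poly_gt0 sm.
have sr : (size (h %% m)%R <= 2)%N by have := ltn_modpN0 h m0; rewrite sm.
rewrite /dvdp; set r := h %% m in sr *.
have r_lin : r = (r`_0)%:P + (r`_1)%:P * 'X.
  apply/polyP => -[|[|i]]; rewrite coefD coefC coefMX coefC /= ?addr0 ?add0r //.
  by rewrite nth_default // (leq_trans sr).
have : eval_sqrt2 r = 0.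
  have := e; rewrite {1}(divp_eq h m) rmorphD rmorphM eval_sqrt2_modulus mulr0.
  by rewrite add0r.
by rewrite r_lin eval_sqrt2_linear => -[-> ->]; rewrite mul0r addr0.
Qed.

Lemma one_plus_sqrt2_pth_powerP p : one_plus_sqrt2_pth_power p q <->
  exists x : zsqrt2 'F_q, x ^+ p = zpair 1 1.
Proof.
have eval1X : eval_sqrt2 (1 + 'X) = zpair 1 1 by rewrite -eval_sqrt2_linear mul1r.
split=> [[f]|[x xp]].
  rewrite dvdp_eval_sqrt2 rmorphB rmorphXn eval1X subr_eq0 => /eqP e.
  by exists (eval_sqrt2 f).
exists ((x.1)%:P + (x.2)%:P * 'X).
rewrite dvdp_eval_sqrt2 rmorphB rmorphXn eval1X eval_sqrt2_linear subr_eq0 -xp.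
by case: x {xp}.
Qed.

End PthPowers.

Definition zconj (R : comNzRingType) (x : zsqrt2 R) : zsqrt2 R :=
  zpair x.1 (- x.2).

Lemma zconjX (R : comNzRingType) (x : zsqrt2 R) n :
  zconj (x ^+ n) = zconj x ^+ n.
Proof.
elim: n => [|n IHn]; first by rewrite !expr0 /zconj /zpair /= oppr0.
rewrite !exprS -IHn /zconj /zpair !zsqrt2_mulE.
by congr (_, _) => /=; ring.
Qed.

(** Conjugation turns a [p]-th root of [1 - sqrt2] into one of [1 + sqrt2]. *)
Lemma npre_not_power q p : ~ one_plus_sqrt2_pth_power p q ->
  npre_conj_unit q p = 0%N.
Proof.
move=> npow; apply/eqP; rewrite cards_eq0; apply/eqP/setP => x.
rewrite !inE; apply/eqP => xp; apply: npow; apply/one_plus_sqrt2_pth_powerP.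
by exists (zconj x); rewrite -zconjX xp /zconj /zpair /= opprK.
Qed.

(** As [p] divides [q + 1], it divides the order [q ^ 2 - 1] of the unit group, so one [p]-th root,
    here a conjugate, yields exactly [p]. *)
Lemma npre_power q p : prime q -> prime p -> ((q + 1) %% p == 0)%N ->
  legendre 2 q = -1 -> one_plus_sqrt2_pth_power p q -> npre_conj_unit q p = p.
Proof.
move=> q_pr p_pr qN1 leg /one_plus_sqrt2_pth_powerP[x xp].
have h (a : 'F_q) : a ^+ 2 != 2 by apply: legendre2_N1P.
apply: (@card_pth_roots (zsqrt2_finField h)) => //.
- rewrite [#|_|](_ : _ = q ^ 2)%N; last first.
    by rewrite expnS expn1 -[X in _ = (X * X)%N](card_Fp q_pr) -card_prod.
  by rewrite -subn1 (subn_sqr q 1) dvdn_mull.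
- by exists (zconj x); rewrite -[LHS]zconjX xp.
Qed.

(** * Base change and first-order expansion of the form *)

Section ZSqrt2Map.
Variables (R S : comNzRingType) (f : {rmorphism R -> S}).

Definition zmap (x : zsqrt2 R) : zsqrt2 S := zpair (f x.1) (f x.2).

Lemma zmapM x y : zmap (x * y) = zmap x * zmap y.
Proof.
by rewrite /zmap /zpair !zsqrt2_mulE /= !rmorphD !rmorphM rmorph_nat.
Qed.

Lemma zmap_sqrt2 : zmap (sqrt2 R) = sqrt2 S.
Proof. by rewrite /zmap /= rmorph0 rmorph1. Qed.

Lemma zmapX x n : zmap (x ^+ n) = zmap x ^+ n.
Proof.
elim: n => [|n IHn]; first by rewrite !expr0 /zmap /= rmorph0 rmorph1.
by rewrite !exprS zmapM IHn.
Qed.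

Lemma lsum_zmap x : lsum (zmap x) = f (lsum x).
Proof. by rewrite /lsum rmorphD. Qed.

End ZSqrt2Map.

Lemma expr_taylor2 (R : comNzRingType) (x d : R) n :
  (x + d) ^+ n.+2 = x ^+ n.+2 + x ^+ n.+1 * d *+ n.+2 +
    \sum_(i < n.+1) x ^+ (n - i) * d ^+ i.+2 *+ 'C(n.+2, i.+2).
Proof.
rewrite exprDn !big_ord_recl subn0 expr0 mulr1 bin0 mulr1n addrA.
by rewrite /= /bump /= subn1 expr1 bin1.
Qed.

(** For [q <> p], [s * i >= s + 1] suffices. For [q = p] one more factor is required: the binomial
    coefficient supplies it when [i < p], and [s * p >= s + 2] when [i = p], because [p >= 3]. *)
Lemma dvdn_taylor_coef p q s i : prime p -> odd p -> prime q -> (0 < s)%N ->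
  (1 < i <= p)%N -> (q ^ (s + (q == p)).+1 %| 'C(p, i) * q ^ (s * i))%N.
Proof.
move=> p_pr p_odd q_pr s_gt0 /andP[i_gt1 i_le].
have [->|_] := eqVneq q p; last first.
  by apply: dvdn_mull; apply: dvdn_exp2l; nia.
have p_gt2 := odd_prime_gt2 p_odd p_pr.
move: i_le; rewrite leq_eqVlt => /orP[/eqP -> | i_lt].
  by apply: dvdn_mull; apply: dvdn_exp2l; nia.
rewrite addn1 expnS; apply: dvdn_mul; first by apply: prime_dvd_bin => //; lia.
by apply: dvdn_exp2l; nia.
Qed.

Section Taylor.
Variables p q s a b : nat.
Hypotheses (p_pr : prime p) (p_odd : odd p) (q_pr : prime q) (s_gt0 : (0 < s)%N).

(** [p * dFa] and [p * dFb] are the partial derivatives of the form at [(a, b)]. *)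
Definition dFa : int := lsum (zpair a%:R b%:R ^+ p.-1).
Definition dFb : int := lsum (sqrt2 int * zpair a%:R b%:R ^+ p.-1).

(** The boolean [q == p] counts the factors [q] of [p], so the error term lies one power of [q]
    beyond [p * q ^ s]. *)
Lemma Fp_taylor (x y : nat) : exists z : int,
  (Fp p (a + q ^ s * x) (b + q ^ s * y))%:Z = (Fp p a b)%:Z +
  (p * q ^ s)%:Z * (x%:Z * dFa + y%:Z * dFb) + (q ^ (s + (q == p)).+1)%:Z * z.
Proof.
set D := (q ^ (s + (q == p)).+1)%:Z.
rewrite -!natz !natr_Fp; set alpha := zpair a%:R b%:R.
pose delta : zsqrt2 int := zpair x%:R y%:R.
pose M := (q ^ s)%:R : int.
have -> : zpair (a + q ^ s * x)%:R (b + q ^ s * y)%:R = alpha + emb M * delta.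
  rewrite zsqrt2_mulE; congr (_, _); rewrite /= !natrD !natrM /M; ring.
have [n pn] : exists n, p = n.+2.
  by exists p.-2; have := prime_gt1 p_pr; lia.
pose divD (u : zsqrt2 int) := exists v, u = emb D * v.
have [v ev] : divD (\sum_(i < n.+1)
    alpha ^+ (n - i) * (emb M * delta) ^+ i.+2 *+ 'C(n.+2, i.+2)).
  apply: (big_ind divD) => [|u1 u2 [v1 ->] [v2 ->]|i _].
  - by exists 0; rewrite mulr0.
  - by exists (v1 + v2); rewrite mulrDr.
  have : (q ^ (s + (q == p)).+1 %| 'C(p, i.+2) * q ^ (s * i.+2))%N.
    by apply: dvdn_taylor_coef => //; have := ltn_ord i; lia.
  rewrite pn => /dvdnP[k ek].
  have key : emb 'C(n.+2, i.+2)%:R * emb (M ^+ i.+2) = emb D * emb k%:R.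
    by rewrite -!embM /M -natrX -expnM -natrM ek natrM mulrC /D pn natz.
  exists (emb k%:R * (alpha ^+ (n - i) * delta ^+ i.+2)).
  rewrite [RHS]mulrA -key exprMn -embX -mulr_natl -[_%:R](rmorph_nat (@emb int)).
  by rewrite -[RHS]mulrA; congr (_ * _); apply: mulrCA.
exists (lsum v).
have lin : lsum (alpha ^+ n.+1 * delta) = x%:Z * dFa + y%:Z * dFb.
  rewrite /dFa /dFb [in RHS]pn -/alpha -!natz; set A := alpha ^+ _.
  rewrite [delta]zsqrt2E mulrDr lsumD [A * emb _]mulrC lsumZ.
  by rewrite [A * _]mulrCA lsumZ [A * _]mulrC.
rewrite pn expr_taylor2 ev 2!lsumD lsumZ; congr (_ + _ + _).
rewrite lsumMn mulrCA lsumZ lin.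
by rewrite -[LHS]mulr_natl natrM mulrA /M !natz.
Qed.

End Taylor.

(** * Hensel lifting *)

Lemma dvdz_addMr (d m n : int) : (d %| m + d * n)%Z = (d %| m)%Z.
Proof. by rewrite rpredDr // dvdz_mulr ?dvdzz. Qed.

Lemma Fp_modE p a b k :
  (Fp p a b %% k == 1 %% k)%N = (k %| (Fp p a b)%:Z - 1)%Z.
Proof. by rewrite -eqz_mod_dvd !modz_nat. Qed.

Lemma dF_not_both0 p q a b : prime p -> prime q ->
  (Fp p a b %% q == 1 %% q)%N -> ~~ ((q %| dFa p a b)%Z && (q %| dFb p a b)%Z).
Proof.
move=> p_pr q_pr F1; have ch := pchar_Fp q_pr.
rewrite !(dvdz_pcharf ch); apply/negP => /andP[/eqP ua /eqP ub].
have zmapE : zmap (intr : {rmorphism int -> 'F_q}) (zpair a%:R b%:R) = zpair a%:R b%:R.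
  by rewrite /zmap /= !rmorph_nat.
have y0 : (zpair a%:R b%:R : zsqrt2 'F_q) ^+ p.-1 = 0.
  apply: lsum_eq0; rewrite -zmapE -zmapX ?lsum_zmap //.
  by rewrite -(zmap_sqrt2 (intr : {rmorphism int -> 'F_q})) -zmapM lsum_zmap.
have F0 : (Fp p a b)%:R = 0 :> 'F_q.
  by rewrite natr_Fp -(prednK (prime_gt0 p_pr)) exprS y0 mulr0 raddf0.
have : (Fp p a b)%:R = 1%:R :> 'F_q.
  by apply: ord_inj; rewrite !val_Fp_nat //; apply/eqP.
by rewrite F0 => /eqP; rewrite eq_sym oner_eq0.
Qed.

Lemma card_dvdz_linear q (c u v : int) : prime q ->
  ~~ ((q %| u)%Z && (q %| v)%Z) ->
  #|[set z : 'I_q * 'I_q | (q %| c + (z.1%:Z * u + z.2%:Z * v))%Z]| = q.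
Proof.
move=> q_pr; have ch := pchar_Fp q_pr; rewrite !(dvdz_pcharf ch) negb_and => uv.
rewrite -[RHS](card_Fp q_pr) -(card_linear_eq (- c%:~R) uv).
rewrite -(card_ord_Fp (fun z => _ * z.1 + _ * z.2 == _)) //.
apply: eq_card => z; rewrite !inE (dvdz_pcharf ch) /=.
rewrite rmorphD rmorphD !rmorphM /= addrC addr_eq0.
by rewrite ![_%:~R * z.1%:R]mulrC ![_%:~R * z.2%:R]mulrC.
Qed.

(** The moduli of the pairs and of the congruence are separate because, for [q = p], pairs modulo
    [p ^ s] with [s >= 1] determine the form modulo [p ^ (s+1)]. *)
Definition npts p m k :=
  #|[set ab : 'I_m * 'I_m | (Fp p ab.1 ab.2 %% k == 1 %% k)%N]|.

Lemma sum_ord_mul m n (F : nat -> nat) :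
  (\sum_(a < m * n) F a = \sum_(a < m) \sum_(x < n) F (a + m * x)%N)%N.
Proof.
elim: n => [|n IHn].
  by rewrite muln0 big_ord0 big1 // => a _; rewrite big_ord0.
rewrite mulnSr big_split_ord /= IHn -big_split; apply: eq_bigr => a _ /=.
by rewrite big_ord_recr /= addnC [(m * n + a)%N]addnC addnC.
Qed.

Lemma card_pairs_sum m (P : nat -> nat -> bool) :
  (#|[set z : 'I_m * 'I_m | P z.1 z.2]| = \sum_(a < m) \sum_(b < m) P a b)%N.
Proof.
rewrite pair_bigA -sum1_card big_mkcond /=; apply: eq_bigr => z _.
by rewrite inE; case: (P _ _).
Qed.

Lemma card_pairs_mul m n (P : nat -> nat -> bool) :
  (#|[set z : 'I_(m * n) * 'I_(m * n) | P z.1 z.2]| =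
   \sum_(w : 'I_m * 'I_m)
     #|[set z : 'I_n * 'I_n | P (w.1 + m * z.1) (w.2 + m * z.2)]|)%N.
Proof.
rewrite card_pairs_sum (sum_ord_mul _ _ (fun a => \sum_(b < m * n) P a b)%N).
rewrite -(pair_bigA _ (fun a b : 'I_m =>
  #|[set z : 'I_n * 'I_n | P (a + m * z.1) (b + m * z.2)]|)%N) /=.
apply: eq_bigr => a _.
under eq_bigr => x _ do rewrite (sum_ord_mul _ _ (fun b => nat_of_bool (P (a + m * x)%N b))).
rewrite exchange_big /=; apply: eq_bigr => b _.
by rewrite (card_pairs_sum _ (fun x y => P (a + m * x) (b + m * y))%N).
Qed.

(** Above a solution, the lifts [(a + q ^ s x, b + q ^ s y)] are cut out by a nontrivial affine
    equation in [(x, y)] over [F_q], so there are [q] of them; above a non-solution there are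
    none. *)
Lemma hensel_step p q s : prime p -> odd p -> prime q -> (0 < s)%N ->
  (npts p (q ^ s.+1) (q ^ (s.+1 + (q == p))) =
   q * npts p (q ^ s) (q ^ (s + (q == p))))%N.
Proof.
move=> p_pr p_odd q_pr s_gt0; rewrite addSn; set e := nat_of_bool (q == p).
rewrite (expnSr q s) /npts.
rewrite (card_pairs_mul _ _ (fun a b => Fp p a b %% q ^ (s + e).+1 == 1 %% q ^ (s + e).+1)%N).
rewrite -sum1_card big_distrr /= [RHS]big_mkcond /=; apply: eq_bigr => -[a b] _.
rewrite inE /=.
set k := (q ^ (s + e))%N; have kq : (q ^ (s + e).+1 = k * q)%N by rewrite expnSr.
have k0 : (k%:Z != 0) by rewrite eqz_nat -lt0n expn_gt0 prime_gt0.
(* The cofactor [p'] is 1 if [q = p] and [p] otherwise; being prime to [q], it keeps the linear part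
   nonzero. *)
have [p' pq p'q] : exists2 p', (p * q ^ s = k * p')%N & ~~ (q %| p')%N.
  rewrite /k /e; have [->|qp] := eqVneq q p.
    by exists 1%N; [rewrite addn1 expnS muln1 | rewrite dvdn1 gtn_eqF ?prime_gt1].
  by exists p; [rewrite addn0 mulnC | rewrite dvdn_prime2].
have taylor := Fp_taylor a b p_pr p_odd q_pr s_gt0.
case: ifPn => F1; last first.
  (* A pair and its lifts have the same value modulo [k]. *)
  apply/eqP; rewrite cards_eq0; apply/eqP/setP => -[x y]; rewrite !inE /=.
  apply: contraNF F1; rewrite !Fp_modE; have [z ->] := taylor x y.
  rewrite -/e kq pq !PoszM -!mulrA => dv.
  have : (k %| (Fp p a b)%:Z - 1 +
           k%:Z * (p'%:Z * (x%:Z * dFa p a b + y%:Z * dFb p a b) + q%:Z * z))%Z.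
    apply: dvdz_trans (dvdz_mulr q%:Z (dvdzz k%:Z)) _.
    by congr (_ %| _)%Z: dv; ring.
  by rewrite dvdz_addMr.
have := F1; rewrite Fp_modE => /dvdzP[c ec].
rewrite muln1 -[RHS](@card_dvdz_linear q c (p'%:Z * dFa p a b) (p'%:Z * dFb p a b)) //.
  apply: eq_card => -[x y]; rewrite !inE /= Fp_modE; have [z ->] := taylor x y.
  rewrite -/e kq pq !PoszM.
  have -> : (Fp p a b)%:Z = c * k%:Z + 1 by rewrite -ec subrK.
  (* With [c = (F - 1) / k], dividing by [k] leaves the affine equation modulo [q]. *)
  transitivity (k%:Z * q%:Z %| k%:Z * ((c + (x%:Z * (p'%:Z * dFa p a b) +
     y%:Z * (p'%:Z * dFb p a b))) + q%:Z * z))%Z.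
    by congr (_ %| _)%Z; ring.
  by rewrite dvdz_mul2l // dvdz_addMr.
have cop : coprimez q p' by rewrite coprimezE /= prime_coprime.
rewrite !(Gauss_dvdzr _ cop); apply: dF_not_both0 => //.
rewrite Fp_modE; apply: dvdz_trans _ (_ : (k %| _)%Z); last by rewrite -Fp_modE.
by rewrite /k -(prednK s_gt0) addSn expnS PoszM dvdz_mulr ?dvdzz.
Qed.

Lemma npts_hensel p q s : prime p -> odd p -> prime q ->
  (npts p (q ^ s.+1) (q ^ (s.+1 + (q == p))) = q ^ s * npts p q (q ^ (q == p).+1))%N.
Proof.
move=> p_pr p_odd q_pr; elim: s => [|s IHs]; first by rewrite mul1n expn1.
by rewrite hensel_step // IHs mulnA -expnS.
Qed.

Lemma Npairs_neq p q s : prime p -> odd p -> prime q -> q != p ->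
  (Npairs p (q ^ s.+1) = q ^ s * nsol q p)%N.
Proof.
move=> p_pr p_odd q_pr qp; have := npts_hensel s p_pr p_odd q_pr.
by rewrite (negbTE qp) addn0 expn1 -Npairs_prime.
Qed.

(** The value modulo [p ^ (s+2)] depends only on the pair modulo [p ^ (s+1)], so either all [p ^ 2]
    lifts of such a pair are solutions or none is. *)
Lemma Npairs_char p s : prime p -> odd p ->
  (Npairs p (p ^ s.+2) = p * p ^ s.+1 * npts p p (p ^ 2))%N.
Proof.
move=> p_pr p_odd; have := npts_hensel s p_pr p_odd p_pr; rewrite eqxx addn1 => H.
transitivity (p ^ 2 * npts p (p ^ s.+1) (p ^ s.+2))%N; last first.
  by rewrite H !expnS; ring.
rewrite -[LHS]/(npts p _ _) [X in npts p X _ = _]expnSr {1}/npts.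
rewrite (card_pairs_mul _ _ (fun a b => Fp p a b %% p ^ s.+2 == 1 %% p ^ s.+2)%N).
rewrite /npts -sum1_card big_distrr /= [RHS]big_mkcond /=.
apply: eq_bigr => -[a b] _; rewrite inE /=.
have E x y : (Fp p (a + p ^ s.+1 * x) (b + p ^ s.+1 * y) %% p ^ s.+2 ==
    1 %% p ^ s.+2)%N = (Fp p a b %% p ^ s.+2 == 1 %% p ^ s.+2)%N.
  have [z] := Fp_taylor a b p_pr p_odd p_pr (ltn0Sn s) x y.
  rewrite eqxx addn1 !Fp_modE => ->.
  rewrite -expnS [(p ^ s.+3)%N]expnSr PoszM.
  set m := (p ^ s.+2)%N; set t := _ + _ * dFb _ _ _.
  transitivity (m %| ((Fp p a b)%:Z - 1) + m%:Z * (t + p%:Z * z))%Z.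
    by congr (_ %| _)%Z; ring.
  by rewrite dvdz_addMr.
case: ifPn => F1; last first.
  by apply/eqP; rewrite cards_eq0; apply/eqP/setP => z; rewrite !inE E; apply: negbTE.
transitivity #|[set: 'I_p * 'I_p]|; last by rewrite cardsT card_prod card_ord muln1.
by apply: eq_card => z; rewrite !inE E F1.
Qed.

(** * The solution [(1, 0)] and the assembly of the cases *)

Lemma Fp_1_0 p : Fp p 1 0 = 1%N.
Proof.
rewrite /Fp big_ord_recl big1 => [|i _]; last by rewrite exp0n ?muln0.
by rewrite bin0 exp1n expn0.
Qed.

Lemma npts_gt0 p m k : (1 < m)%N -> (0 < npts p m k)%N.
Proof.
move=> m_gt1; have m_gt0 := ltnW m_gt1; apply/card_gt0P.
by exists (Ordinal m_gt1, Ordinal m_gt0); rewrite inE Fp_1_0.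
Qed.

Local Close Scope ring_scope.

Theorem theorem10p1 (p q : nat) :
  prime p -> odd p -> prime q ->
  (forall s : nat, 1 <= s ->
     (* (1) *)
     ((  (q != p) && (q != 2) && (q %% p != 1) && ((q + 1) %% p != 0)
      \/ ((q + 1) %% p == 0 /\ legendre 2 q = 1%R)
      \/ (q == p) && (s == 1)) ->
      Npairs p (q ^ s) = q ^ s)
     (* (2) *)
  /\ (((q + 1) %% p == 0 /\ legendre 2 q = (-1)%R) ->
      (~ one_plus_sqrt2_pth_power p q ->
         Npairs p (q ^ s) = q ^ s + q ^ s.-1)
   /\ (one_plus_sqrt2_pth_power p q ->
         ((Npairs p (q ^ s))%:Z = (q ^ s)%:Z + (1 - p%:Z) * (q ^ s.-1)%:Z)%R))
     (* (3) *)
  /\ (q = 2 -> Npairs p (q ^ s) = 2 ^ s.-1))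
  /\
  (* (4) *)
  (exists d : nat, 0 < d /\
     forall s : nat, 1 <= s ->
       (q %% p == 1) || ((q == p) && (1 < s)) ->
       Npairs p (q ^ s) = p * q ^ s.-1 * d).
Proof.
move=> p_pr p_odd q_pr.
have neq_of_N1 : (q + 1) %% p == 0 -> q != p.
  move=> h; apply: contraTneq h => ->.
  by rewrite -modnDml modnn modn_small ?prime_gt1.
have Nneq s : 1 <= s -> q != p -> Npairs p (q ^ s) = q ^ s.-1 * nsol q p.
  by case: s => // s _ qp; rewrite (Npairs_neq _ p_pr).
split=> [s s_gt0|].
  have qs : q ^ s = q ^ s.-1 * q by rewrite -expnSr prednK.
  split; [|split].
  - case=> [/andP[/andP[/andP[qp q2] q1] qN1]|[[qN1 leg]|/andP[/eqP -> /eqP ->]]].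
    + have q_odd : odd q by case: (even_prime q_pr) q2 => [->|].
      by rewrite Nneq // (nsol_not_pm1 q_pr p_pr).
    + by rewrite Nneq ?neq_of_N1 // (nsol_split q_pr p_pr).
    + by rewrite expn1 Npairs_prime // nsol_char.
  - case=> qN1 leg; have E := nsol_nonsplit q_pr p_pr p_odd qN1 leg.
    rewrite Nneq ?neq_of_N1 //; split=> pow.
      by move: E; rewrite (npre_not_power pow) addn0 qs => ->; rewrite mulnS addnC.
    rewrite (npre_power q_pr p_pr qN1 leg pow) in E.
    have nE : (nsol q p)%:Z%R = (q%:Z + (1 - p%:Z))%R by lia.
    by rewrite qs !PoszM nE mulrDr [((1 - _) * _)%R]mulrC.
  - move=> q2; subst q; rewrite Nneq // ?nsol_2 ?prime_gt1 ?muln1 //.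
    by apply: contraTneq p_odd => <-.
have [qp|qp] := eqVneq q p.
  (* For [q = p], [d] counts the pairs modulo [p] with form 1 modulo [p ^ 2]. *)
  exists (npts p p (p ^ 2)); split; first by rewrite npts_gt0 ?prime_gt1.
  rewrite qp modnn => -[|[|s]] _ //= _; exact: Npairs_char.
have [q1|q1] := eqVneq (q %% p) 1; last first.
  (* Neither alternative of (4) holds for any [s], so any positive [d] serves. *)
  by exists 1; split=> // s _; rewrite (negbTE q1).
have /dvdnP[d nd] := dvdn_nsol p_pr q_pr q1.
exists d; split=> [|s s_gt0 _]; last by rewrite Nneq // nd; lia.
have : 0 < nsol q p by rewrite -Npairs_prime // npts_gt0 ?prime_gt1.
by rewrite nd; case: (d).
Qed.
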